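(* Let $1\le j\le n-1$ and let $O\subseteq Q$ be an order ideal of the type $(A_{n-1},j)$ poset $Q$ described in the context. An $\oplus$-diagram $D$ of shape $O$ is a $\Gamma$-diagram if and only if there is no box $z\in O$ with $D(z)=0$ such that some box below $z$ (same column, larger row index) contains a $+$ and some box to the left of $z$ (same row, smaller column index) contains a $+$.
   Context: $W=S_n$ is the Weyl group of type $A_{n-1}$ with simple reflections $s_i=(i,i+1)$, $1\le i\le n-1$, length function $\ell$ and Bruhat order $<$. $Q$ is the set of boxes $(r,c)$ with $1\le r\le j$ (rows numbered from top to bottom) and $1\le c\le n-j$ (columns from left to right); box $(r,c)$ carries the label $s_{(r,c)}:=s_{r+c-1}$. The partial order on $Q$ is the transitive closure of $(r,c)\lessdot(r,c+1)$ and $(r,c)\lessdot(r-1,c)$ (a box is smaller than the box to its right and than the box above it); an order ideal is a down-closed subset. An $\oplus$-diagram of shape $O$ is a map $D:O\to\{0,+\}$. Choose a linear extension $b_1,\dots,b_m$ of $O$ (so $b_k<b_l\Rightarrow k<l$) and write $s_{i_t}:=s_{b_{m+1-t}}$, so that $s_{i_1}\cdots s_{i_m}=s_{b_m}\cdots s_{b_1}$ (a reduced word). The subexpression of $D$ is $t_1\cdots t_m$ with $t_t=s_{i_t}$ if $D(b_{m+1-t})=0$ and $t_t=1$ if $D(b_{m+1-t})=+$; set $v_{(0)}=1$, $v_{(k)}=t_1\cdots t_k$, $v(D)=v_{(m)}$. $D$ is called a $\Gamma$-diagram if $v_{(k-1)}<v_{(k-1)}s_{i_k}$ for all $k=1,\dots,m$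 (a positive distinguished subexpression); this notion does not depend on the chosen linear extension. *)

(* Defs.v *)
From mathcomp Require Import all_boot all_fingroup zify.

Set Implicit Arguments.
Unset Strict Implicit.
Unset Printing Implicit Defensive.

Local Open Scope group_scope.

(** * The Coxeter group [S_n]

    All indices are 0-based: [simple_refl i] exchanges [i] and [i+1], i.e. it is
    [s_(i+1)] in 1-based notation.  Products in ['S_n] compose from left to
    right; with either convention [('S_n, s_i)] is the same Coxeter system, up
    to the isomorphism [w |-> w^-1]. *)

Lemma adj_ltn0 n (i : 'I_n.-1) : (i < n)%N.
Proof. by have := ltn_ord i; lia. Qed.

Lemma adj_ltn1 n (i : 'I_n.-1) : (i.+1 < n)%N.
Proof. by have := ltn_ord i; lia. Qed.

Definition simple_refl n (i : 'I_n.-1) : 'S_n :=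
  tperm (Ordinal (adj_ltn0 i)) (Ordinal (adj_ltn1 i)).

Definition word_prod n (s : seq 'I_n.-1) : 'S_n :=
  \prod_(i <- s) simple_refl i.

Definition has_word n (w : 'S_n) (k : nat) : bool :=
  [exists s : k.-tuple 'I_n.-1, word_prod s == w].

Lemma tperm_word n (d : nat) (x y : 'I_n) :
  (y = x + d.+1 :> nat)%N -> exists s, tperm x y = word_prod s.
Proof.
elim: d y => [|d IHd] y dy.
  have lt_x : (x < n.-1)%N by have := ltn_ord y; lia.
  exists [:: Ordinal lt_x]; rewrite /word_prod big_seq1 /simple_refl.
  by congr tperm; apply: val_inj => //=; lia.
have lt_y : (y.-1 < n.-1)%N by have := ltn_ord y; lia.
pose i := Ordinal lt_y; pose y' := Ordinal (adj_ltn0 i).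
have Ey : y = Ordinal (adj_ltn1 i) by apply: val_inj => /=; lia.
have [|s Es] := IHd y'; first by rewrite /=; lia.
exists (i :: s ++ [:: i]); rewrite /word_prod big_cons big_cat big_seq1 /=.
rewrite -/(word_prod s) -Es.
have -> : simple_refl i = tperm y' y by rewrite Ey.
rewrite -{1}[tperm y' y]tpermV -conjgE tpermJ tpermL tpermD //;
  by rewrite -(inj_eq val_inj) /=; lia.
Qed.

Lemma has_word_exists n (w : 'S_n) : exists k, has_word w k.
Proof.
suff [s ->] : exists s, w = word_prod s.
  by exists (size s); apply/existsP; exists (in_tuple s); apply/eqP.
have [ts -> dts] := prod_tpermP w; elim: ts dts => [|[x y] ts IHts] /=.
  by move=> _; exists [::]; rewrite /word_prod !big_nil.
case/andP=> nxy /IHts[s Es]; rewrite big_cons Es /=.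
suff [t ->] : exists t, tperm x y = word_prod t.
  by exists (t ++ s); rewrite /word_prod big_cat.
rewrite /dpair /= -(inj_eq val_inj) /= neq_ltn in nxy.
case/orP: nxy => lt_xy; last rewrite tpermC.
  by apply: (@tperm_word _ (y - x).-1); lia.
by apply: (@tperm_word _ (x - y).-1); lia.
Qed.

Definition coxeter_length n (w : 'S_n) : nat := ex_minn (has_word_exists w).

Definition is_reflection n (t : 'S_n) : bool :=
  [exists i : 'I_n.-1, exists w : 'S_n, t == simple_refl i ^ w].

Definition bruhat_step n (u w : 'S_n) : bool :=
  is_reflection (u^-1 * w) && (coxeter_length u < coxeter_length w)%N.

Definition bruhat_lt n (u w : 'S_n) : bool :=
  (u != w) && connect (@bruhat_step n) u w.

(** * The poset [Q]

    [z.1] is the row (numbered from top to bottom) and [z.2] the column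
    (numbered from left to right), both 0-based. *)

Notation box n j := ('I_j * 'I_(n - j))%type.

Definition box_cover n j (x y : box n j) : bool :=
     (x.1 == y.1) && (y.2 == x.2.+1 :> nat)
  || (x.1 == y.1.+1 :> nat) && (x.2 == y.2).

Definition box_le n j : rel (box n j) := connect (@box_cover n j).

Definition box_lt n j (x y : box n j) : bool := (x != y) && box_le x y.

Lemma box_label_subproof n j (z : box n j) : (z.1 + z.2 < n.-1)%N.
Proof. by have := ltn_ord z.1; have := ltn_ord z.2; lia. Qed.

(* The 1-based index [r + c - 1] becomes [r + c] with 0-based [r], [c]. *)
Definition box_refl n j (z : box n j) : 'S_n :=
  simple_refl (Ordinal (box_label_subproof z)).

Definition order_ideal n j (O : {set box n j}) : Prop :=
  forall x y : box n j, box_le x y -> y \in O -> x \in O.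

Notation boxes_of O := {z | z \in O}.

Definition linear_extension n j (O : {set box n j}) m
    (b : m.-tuple (boxes_of O)) : Prop :=
  [/\ uniq b, forall z : boxes_of O, z \in b
    & forall k l : 'I_m,
        box_lt (val (tnth b k)) (val (tnth b l)) -> (k < l)%N].

(** * Diagrams *)

Variant entry := Zero | Plus.

Definition oplus_diagram n j (O : {set box n j}) := boxes_of O -> entry.

Definition factor n j (O : {set box n j}) (D : oplus_diagram O)
    (z : boxes_of O) : 'S_n :=
  match D z with Zero => box_refl (val z) | Plus => 1 end.

(* [rev b] lists the boxes in the order of the word [s_(b_m) ... s_(b_1)]. *)
Definition partial_prod n j (O : {set box n j}) m
    (b : m.-tuple (boxes_of O)) (D : oplus_diagram O) (k : nat) : 'S_n :=
  \prod_(z <- take k (rev b)) factor D z.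

(* As [k] is 0-based, [v] is the product of the factors preceding the letter
   [tnth (rev_tuple b) k]. *)
Definition Gamma_diagram n j (O : {set box n j}) m
    (b : m.-tuple (boxes_of O)) (D : oplus_diagram O) : Prop :=
  forall k : 'I_m,
    let v := partial_prod b D k in
    bruhat_lt v (v * box_refl (val (tnth (rev_tuple b) k))).

Definition is_below n j (y z : box n j) : bool :=
  (y.2 == z.2) && (z.1 < y.1)%N.

Definition is_left_of n j (x z : box n j) : bool :=
  (x.1 == z.1) && (x.2 < z.2)%N.

(* Main.v *)
(** Draw two strands in each box: a [Zero] is a crossing (top to bottom, right to
    left), a [Plus] a pair of elbows (top to left, right to bottom).  Reading the
    word traces [n] wires travelling down and left, and, by the exchange
    property, [v < v s] at a letter says that the two wires meeting in its box
    have not crossed (an odd number of times) before.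

    If two wires cross at [z] and meet again, then the one leaving [z] downwards
    must have turned left, at a [Plus] below [z], and the other one must have
    turned down, at a [Plus] to the left of [z].  Conversely, take a [Zero] at [z]
    with a [Plus] [y] below and a [Plus] [x] to the left spanning a smallest
    rectangle.  By minimality all other boxes on the boundary of the rectangle,
    except possibly the corner opposite to [z], are [Zero], so the wires that
    cross at [z] meet again at that corner. *)

Require Import Defs.
From mathcomp Require Import all_boot all_fingroup zify.

Set Implicit Arguments.
Unset Strict Implicit.
Unset Printing Implicit Defensive.

Local Open Scope group_scope.

(** * Bruhat comparison with a simple reflection *)

Lemma simple_reflE n (i : 'I_n.-1) (x : 'I_n) :
  simple_refl i x = (if x == i :> nat then i.+1
                     else if x == i.+1 :> nat then i : nat else x) :> nat.
Proof.
rewrite /simple_refl permE /= -!(inj_eq val_inj) /=.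
by do 2![case: ifP => //= _].
Qed.

Lemma simple_reflK n (i : 'I_n.-1) (w : 'S_n) :
  w * simple_refl i * simple_refl i = w.
Proof. by rewrite -mulgA tperm2 mulg1. Qed.

(* The exchange property, stated for all transpositions so that the induction
   on the word goes through. *)
Lemma word_exchange n (s : seq 'I_n.-1) (x y : 'I_n) :
    (x < y)%N -> ((word_prod s)^-1 y < (word_prod s)^-1 x)%N ->
  exists2 s', (size s' < size s)%N & word_prod s' = word_prod s * tperm x y.
Proof.
elim/last_ind: s x y => [|s i IHs] x y lt_xy.
  by rewrite /word_prod big_nil invg1 !perm1; lia.
have Es t : word_prod (rcons t i) = word_prod t * simple_refl i.
  by rewrite /word_prod -cats1 big_cat big_seq1.
rewrite Es invMg !permM tpermV -/(simple_refl i) size_rcons => lt_yx.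
have [/andP[/eqP Ex /eqP Ey]|neq] := boolP ((x == i :> nat) && (y == i.+1 :> nat)).
  exists s => //; have -> : tperm x y = simple_refl i.
    by rewrite /simple_refl; congr tperm; apply: val_inj.
  by rewrite simple_reflK.
have [|s' lt_s' Es'] := IHs (simple_refl i x) (simple_refl i y) _ lt_yx.
  by rewrite !simple_reflE; do 4?case: ifP; lia.
exists (rcons s' i); first by rewrite size_rcons.
rewrite Es Es' -!mulgA; congr (_ * _).
by rewrite -tpermJ conjgE tpermV -/(simple_refl i) !mulgA simple_reflK.
Qed.

Lemma coxeter_length_word n (w : 'S_n) :
  exists2 s, word_prod s = w & size s = coxeter_length w.
Proof.
rewrite /coxeter_length; case: ex_minnP => k /existsP[s /eqP Es] _.
by exists s; rewrite ?size_tuple.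
Qed.

Lemma coxeter_length_le n (s : seq 'I_n.-1) :
  (coxeter_length (word_prod s) <= size s)%N.
Proof.
rewrite /coxeter_length; case: ex_minnP => k _; apply.
by apply/existsP; exists (in_tuple s).
Qed.

(** Exchange, applied to a shortest word of [w], gives a shorter word of [w * simple_refl i]. *)
Lemma coxeter_length_descent n (w : 'S_n) (i : 'I_n.-1) :
    (w^-1 (Ordinal (adj_ltn1 i)) < w^-1 (Ordinal (adj_ltn0 i)))%N ->
  (coxeter_length (w * simple_refl i) < coxeter_length w)%N.
Proof.
have [s <- <-] := coxeter_length_word w => lt_w.
have [//|s' lt_s' <-] := word_exchange _ lt_w.
exact: leq_ltn_trans (coxeter_length_le s') lt_s'.
Qed.

Lemma connect_bruhat_length n (u w : 'S_n) :
  connect (@bruhat_step n) u w -> (coxeter_length u <= coxeter_length w)%N.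
Proof.
case/connectP=> p + ->; elim: p u => //= v p IHp u /andP[/andP[_ lt_uv] /IHp].
exact/leq_trans/ltnW.
Qed.

(** Length is monotone along Bruhat chains, so the sign of the length change decides; [w^-1] turns
    positions into wires. *)
Lemma bruhat_lt_simple n (w : 'S_n) (i : 'I_n.-1) :
  bruhat_lt w (w * simple_refl i) =
  (w^-1 (Ordinal (adj_ltn0 i)) < w^-1 (Ordinal (adj_ltn1 i)))%N.
Proof.
case: ltnP => [lt_w|].
  have lt_l : (coxeter_length w < coxeter_length (w * simple_refl i))%N.
    (* An ascent of [w] at [i] is a descent of [w * simple_refl i]. *)
    rewrite -{1}(simple_reflK i w); apply: coxeter_length_descent.
    by rewrite invMg !permM tpermV tpermL tpermR.
  apply/andP; split; first by apply: contraTneq lt_l => <-; rewrite ltnn.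
  apply: connect1; rewrite /bruhat_step lt_l andbT mulKg.
  by apply/existsP; exists i; apply/existsP; exists 1; rewrite conjg1.
rewrite leq_eqVlt => /orP[/eqP/val_inj/perm_inj/(congr1 val)/= |lt_w]; first lia.
apply: contraTF (coxeter_length_descent lt_w) => /andP[_ /connect_bruhat_length].
by rewrite leqNgt.
Qed.

(** * Linear extensions of an order ideal *)

Lemma box_leP n j (x y : box n j) :
  (y.1 <= x.1)%N -> (x.2 <= y.2)%N -> box_le x y.
Proof.
case: x y => [r c] [r' c'] /= le_r le_c.
apply: (@connect_trans _ _ (r', c)).
  have [d Ed] : exists d, (r = r' + d :> nat)%N by exists (r - r')%N; lia.
  elim: d r Ed {le_r} => [|d IHd] r Ed.
    by have -> : r = r' by apply: val_inj => /=; lia.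
  have lt_d : (r' + d < j)%N by have := ltn_ord r; lia.
  apply: (connect_trans _ (IHd (Ordinal lt_d) erefl)); apply: connect1.
  by rewrite /box_cover /= eqxx andbT orbC; lia.
have [d Ed] : exists d, (c' = c + d :> nat)%N by exists (c' - c)%N; lia.
elim: d c' Ed {le_c} => [|d IHd] c' Ed.
  by have -> : c' = c by apply: val_inj => /=; lia.
have lt_d : (c + d < n - j)%N by have := ltn_ord c'; lia.
apply: (connect_trans (IHd (Ordinal lt_d) erefl)); apply: connect1.
by rewrite /box_cover /= eqxx; lia.
Qed.

Section Reading.

Variables (n j : nat) (O : {set box n j}).
Variables (m : nat) (b : m.-tuple (boxes_of O)).

Definition letter_box (k : 'I_m) : boxes_of O := tnth (rev_tuple b) k.

(** Defined on the whole rectangle: boxes outside [O] count as read from the start. *)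
Definition unread (t : nat) (w : box n j) : bool :=
  [exists k : 'I_m, (t <= k)%N && (val (letter_box k) == w)].

Hypothesis hO : order_ideal O.
Hypothesis hb : linear_extension b.

Lemma letter_boxP (z : boxes_of O) : exists k, letter_box k = z.
Proof.
have [_ all_b _] := hb.
have /tnthP[k ->] : z \in rev_tuple b by rewrite mem_rev; apply: all_b.
by exists k.
Qed.

Lemma letter_box_inj : injective letter_box.
Proof.
have [ub _ _] := hb; have : uniq (rev_tuple b) by rewrite /= rev_uniq.
by move/tuple_uniqP.
Qed.

Lemma letter_box_anti (k l : 'I_m) :
    let x := val (letter_box k) in let y := val (letter_box l) in
  (x.1 <= y.1)%N -> (y.2 <= x.2)%N -> (k <= l)%N.
Proof.
move=> x y le1 le2; have [-> //|neq_kl] := eqVneq k l.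
have rev_box i : letter_box i = tnth b (rev_ord i).
  pose z := tnth b i; rewrite /letter_box !(tnth_nth z) /= nth_rev; last by rewrite size_tuple.
  by rewrite size_tuple.
have [_ _ /(_ (rev_ord l) (rev_ord k))] := hb.
rewrite -!rev_box /box_lt box_leP // andbT (inj_eq val_inj).
rewrite (inj_eq letter_box_inj) eq_sym neq_kl => /(_ isT) /=.
by have := ltn_ord l; have := ltn_ord k; lia.
Qed.

Lemma unread_letter (t : nat) (k : 'I_m) :
  unread t (val (letter_box k)) = (t <= k)%N.
Proof.
apply/existsP/idP => [[l /andP[le_tl /eqP/val_inj/letter_box_inj <-]] //|le_tk].
by exists k; rewrite le_tk eqxx.
Qed.

(** The word removes maximal boxes one at a time, so what remains is an order ideal, bordered by a
    lattice path. *)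
Lemma unread_le (t : nat) (x y : box n j) :
  (y.1 <= x.1)%N -> (x.2 <= y.2)%N -> unread t y -> unread t x.
Proof.
move=> le1 le2 /existsP[k /andP[le_tk /eqP Ey]].
have Ox : x \in O by apply: (hO (box_leP le1 le2)); rewrite -Ey (valP (letter_box k)).
have [l El] := letter_boxP (exist _ x Ox).
have Ex : x = val (letter_box l) by rewrite El.
rewrite Ex unread_letter; apply: leq_trans le_tk _.
by apply: letter_box_anti; rewrite Ey -Ex.
Qed.

Lemma unread_max (k : 'I_m) (w : box n j) (z := val (letter_box k)) :
  (w.1 <= z.1)%N -> (z.2 <= w.2)%N -> unread k w -> w = z.
Proof.
move=> le1 le2 /existsP[l /andP[le_kl /eqP Ew]].
suff Elk : l = k by rewrite -Ew Elk.
apply/val_inj/eqP; rewrite eqn_leq le_kl andbT.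
by apply: letter_box_anti; rewrite Ew.
Qed.

Lemma unreadS (k : 'I_m) (w : box n j) :
  unread k.+1 w = unread k w && (w != val (letter_box k)).
Proof.
apply/existsP/andP => [[l /andP[lt_kl /eqP <-]]|[/existsP[l /andP[le_kl /eqP <-]]]].
  rewrite unread_letter ltnW // (inj_eq val_inj) (inj_eq letter_box_inj).
  by rewrite -(inj_eq val_inj) /= gtn_eqF.
rewrite (inj_eq val_inj) (inj_eq letter_box_inj) => neq_lk; exists l.
by rewrite eqxx andbT ltn_neqAle le_kl andbT eq_sym.
Qed.

Lemma unread_row (k : 'I_m) (c : 'I_(n - j)) (z := val (letter_box k)) :
  unread k (z.1, c) = (c <= z.2)%N.
Proof.
have uz : unread k z by rewrite unread_letter.
case: leqP => [le_c|lt_c]; first by apply: unread_le uz.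
apply/idP => uc; have Ez := unread_max (w := (z.1, c)) (leqnn _) (ltnW lt_c) uc.
by move: lt_c; rewrite /z -Ez ltnn.
Qed.

Lemma unread_col (k : 'I_m) (r : 'I_j) (z := val (letter_box k)) :
  unread k (r, z.2) = (z.1 <= r)%N.
Proof.
have uz : unread k z by rewrite unread_letter.
case: leqP => [le_r|lt_r]; first by apply: unread_le uz.
apply/idP => ur; have Ez := unread_max (w := (r, z.2)) (ltnW lt_r) (leqnn _) ur.
by move: lt_r; rewrite /z -Ez ltnn.
Qed.

(** * Wires *)

Variable D : oplus_diagram O.

(* After [t] letters wire [p] is at position [partial_prod b D t p].  Positions
   number the edges of the border between read and unread boxes, from top left to
   bottom right: the top and left edges of box [(r, c)] are at [r + c], its right
   and bottom edges at [r + c + 1].  In [going_down t r c p] the wire is on the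
   top edge of [(r, c)], the first unread box of column [c]; [r = j] means that
   it has reached the bottom. *)
Definition going_down (t r : nat) (c : 'I_(n - j)) (p : 'I_n) : Prop :=
  partial_prod b D t p = (r + c)%N :> nat /\
  forall i : 'I_j, unread t (i, c) = (r <= i)%N.

(* The wire is on the right edge of [(r, c - 1)], the last unread box of row [r];
   [c = 0] means that it has reached the left border. *)
Definition going_left (t : nat) (r : 'I_j) (c : nat) (p : 'I_n) : Prop :=
  [/\ (c <= n - j)%N, partial_prod b D t p = (r + c)%N :> nat
    & forall i : 'I_(n - j), unread t (r, i) = (i < c)%N].

Lemma partial_prodS (k : 'I_m) (p : 'I_n) (z := letter_box k) :
  partial_prod b D k.+1 p = factor D z (partial_prod b D k p).
Proof.
have lt_k : (k < size (rev b))%N by rewrite size_rev size_tuple.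
have Ez : nth z (rev b) k = z by rewrite [RHS](tnth_nth z).
by rewrite /partial_prod (take_nth z) // Ez -cats1 big_cat big_seq1 permM.
Qed.

Lemma partial_prodS_Zero (k : 'I_m) (p : 'I_n) (z := val (letter_box k))
    (x := partial_prod b D k p) :
    D (letter_box k) = Zero ->
  partial_prod b D k.+1 p = (if x == (z.1 + z.2)%N :> nat then (z.1 + z.2).+1
    else if x == (z.1 + z.2).+1 :> nat then (z.1 + z.2)%N else x) :> nat.
Proof. by move=> Dz; rewrite partial_prodS /factor Dz simple_reflE. Qed.

Lemma partial_prodS_Plus (k : 'I_m) (p : 'I_n) :
  D (letter_box k) = Plus -> partial_prod b D k.+1 p = partial_prod b D k p.
Proof. by move=> Dz; rewrite partial_prodS /factor Dz perm1. Qed.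

Lemma partial_prodS_id (k : 'I_m) (p : 'I_n) (z := val (letter_box k))
    (x := partial_prod b D k p) :
    x <> (z.1 + z.2)%N :> nat -> x <> (z.1 + z.2).+1 :> nat ->
  partial_prod b D k.+1 p = x.
Proof.
move=> /eqP/negPf neq0 /eqP/negPf neq1; apply: val_inj => /=.
case Dz: (D (letter_box k)); last by rewrite partial_prodS_Plus.
by rewrite partial_prodS_Zero // neq0 neq1.
Qed.

Lemma unreadS_row (k : 'I_m) (c : 'I_(n - j)) (z := val (letter_box k)) :
  unread k.+1 (z.1, c) = (c < z.2)%N.
Proof.
rewrite unreadS unread_row ltn_neqAle andbC; congr (_ && _).
by rewrite -pair_eqE /= eqxx.
Qed.

Lemma unreadS_col (k : 'I_m) (r : 'I_j) (z := val (letter_box k)) :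
  unread k.+1 (r, z.2) = (z.1 < r)%N.
Proof.
rewrite unreadS unread_col ltn_neqAle andbC; congr (_ && _).
by rewrite -pair_eqE /= eqxx andbT eq_sym.
Qed.

(** * Passage of a wire through the box being read *)

Lemma cross_down (k : 'I_m) (p : 'I_n) (z := val (letter_box k)) :
    D (letter_box k) = Zero -> partial_prod b D k p = (z.1 + z.2)%N :> nat ->
  going_down k.+1 z.1.+1 z.2 p.
Proof.
move=> Dz Ep; split; last exact: unreadS_col.
by rewrite partial_prodS_Zero // Ep eqxx.
Qed.

Lemma turn_left (k : 'I_m) (p : 'I_n) (z := val (letter_box k)) :
    D (letter_box k) = Plus -> partial_prod b D k p = (z.1 + z.2)%N :> nat ->
  going_left k.+1 z.1 z.2 p.
Proof.
move=> Dz Ep; split; [exact: ltnW | | exact: unreadS_row].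
by rewrite partial_prodS_Plus.
Qed.

Lemma cross_left (k : 'I_m) (p : 'I_n) (z := val (letter_box k)) :
    D (letter_box k) = Zero -> partial_prod b D k p = (z.1 + z.2).+1 :> nat ->
  going_left k.+1 z.1 z.2 p.
Proof.
move=> Dz Ep; split; [exact: ltnW | | exact: unreadS_row].
by rewrite partial_prodS_Zero // Ep eqxx; case: eqP => //; lia.
Qed.

Lemma turn_down (k : 'I_m) (p : 'I_n) (z := val (letter_box k)) :
    D (letter_box k) = Plus -> partial_prod b D k p = (z.1 + z.2).+1 :> nat ->
  going_down k.+1 z.1.+1 z.2 p.
Proof.
by move=> Dz Ep; split; [rewrite partial_prodS_Plus | exact: unreadS_col].
Qed.

(** Both sides decide whether box [(z.1, c)] is unread. Hence [r + c] is never [z.1 + z.2 + 1]: a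
    descending wire cannot be on the right edge of the current box. *)
Lemma going_down_letter (k : 'I_m) r c p (z := val (letter_box k)) :
  going_down k r c p -> (r <= z.1)%N = (c <= z.2)%N.
Proof. by case=> _ <-; apply: unread_row. Qed.

Lemma going_left_letter (k : 'I_m) r c p (z := val (letter_box k)) :
  going_left k r c p -> (z.2 < c)%N = (z.1 <= r)%N.
Proof. by case=> _ _ <-; apply: unread_col. Qed.

Lemma going_down_top (k : 'I_m) r p (z := val (letter_box k)) :
  going_down k r z.2 p -> r = z.1.
Proof.
case=> _ up; have := up z.1; rewrite unread_row leqnn => /esym le_rz.
(* This excludes [r = j], so that [r] is the index of a row. *)
have lt_rj : (r < j)%N by apply: leq_ltn_trans le_rz (ltn_ord _).
have := up (Ordinal lt_rj); rewrite unread_col /= leqnn => le_zr.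
by apply/eqP; rewrite eqn_leq le_rz.
Qed.

Lemma going_left_right (k : 'I_m) c p (z := val (letter_box k)) :
  going_left k z.1 c p -> c = z.2.+1.
Proof.
case=> le_c _ up; have := up z.2; rewrite unread_col leqnn => /esym lt_zc.
apply/eqP; rewrite eqn_leq lt_zc andbT leqNgt; apply/negP => lt_zc1.
have lt_c : (z.2.+1 < n - j)%N by lia.
have := up (Ordinal lt_c); rewrite unread_row /= lt_zc1 -/z; lia.
Qed.

Lemma going_down_stay (k : 'I_m) r c p (z := val (letter_box k)) :
    going_down k r c p ->
  r = z.1 /\ c = z.2 \/ going_down k.+1 r c p.
Proof.
move=> down_p; have cmp : (r <= z.1)%N = (c <= z.2)%N := going_down_letter down_p.
have [Ec|/eqP neq] := eqVneq c z.2.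
  by left; split=> //; rewrite Ec in down_p; apply: going_down_top down_p.
have {}neq : c <> z.2 :> nat by move/val_inj.
right; case: down_p => Ep up; split=> [|i].
  by rewrite partial_prodS_id //; rewrite Ep -/z; lia.
rewrite unreadS up -/z andbC; case: eqP => // Ez.
by case: neq; rewrite -Ez.
Qed.

Lemma going_left_stay (k : 'I_m) r c p (z := val (letter_box k)) :
    going_left k r c p ->
  r = z.1 /\ c = z.2.+1 \/ going_left k.+1 r c p.
Proof.
move=> left_p; have cmp : (z.2 < c)%N = (z.1 <= r)%N := going_left_letter left_p.
have [Er|/eqP neq] := eqVneq r z.1.
  by left; split=> //; rewrite Er in left_p; apply: going_left_right left_p.
have {}neq : r <> z.1 :> nat by move/val_inj.
right; case: left_p => le_c Ep up; split=> // [|i].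
  by rewrite partial_prodS_id //; rewrite Ep -/z; lia.
rewrite unreadS up -/z andbC; case: eqP => // Ez.
by case: neq; rewrite -Ez.
Qed.

(** * Straight runs through zeros *)

(** Each letter either misses the wire or is a crossing that moves it one row down. *)
Lemma going_down_run (k l : nat) r c p :
    (k <= l <= m)%N -> going_down k r c p ->
    (forall z : boxes_of O, (val z).2 = c -> (r <= (val z).1)%N -> ~~ unread l (val z) ->
       D z = Zero) ->
  exists2 r', (r <= r')%N & going_down l r' c p.
Proof.
elim: l => [|l IHl] /andP[le_kl le_lm] down_k zeros.
  by exists r => //; have -> : 0%N = k by lia.
move: le_kl; rewrite leq_eqVlt => /predU1P[<-|lt_kl]; first by exists r.
have [||z Ec le_rz /negP read_z|r' le_r' down_l] := IHl; [lia|by []| |].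
  apply: zeros => //; apply/negP => unread_z; apply: read_z.
  by have := unread_z; rewrite (unreadS (Ordinal le_lm)) => /andP[].
have [[Er Ec]|] := going_down_stay (k := Ordinal le_lm) down_l; last by exists r'.
exists r'.+1; first lia; rewrite Er Ec; apply: (cross_down (k := Ordinal le_lm)).
  apply: zeros; [by rewrite Ec| lia| by rewrite unread_letter /= ltnn].
by have [] := down_l; rewrite Er Ec.
Qed.

Lemma going_left_run (k l : nat) r c p :
    (k <= l <= m)%N -> going_left k r c p ->
    (forall z : boxes_of O, (val z).1 = r -> ((val z).2 < c)%N -> ~~ unread l (val z) ->
       D z = Zero) ->
  exists2 c', (c' <= c)%N & going_left l r c' p.
Proof.
elim: l => [|l IHl] /andP[le_kl le_lm] left_k zeros.
  by exists c => //; have -> : 0%N = k by lia.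
move: le_kl; rewrite leq_eqVlt => /predU1P[<-|lt_kl]; first by exists c.
have [||z Er lt_zc /negP read_z|c' le_c' left_l] := IHl; [lia|by []| |].
  apply: zeros => //; apply/negP => unread_z; apply: read_z.
  by have := unread_z; rewrite (unreadS (Ordinal le_lm)) => /andP[].
have [[Er Ec]|] := going_left_stay (k := Ordinal le_lm) left_l; last by exists c'.
exists (val (letter_box (Ordinal le_lm))).2; first lia.
rewrite Er; apply: (cross_left (k := Ordinal le_lm)).
  apply: zeros; [by rewrite Er| lia| by rewrite unread_letter /= ltnn].
by have [] := left_l; rewrite Er Ec addnS.
Qed.

(** When [y] is about to be read, only the boxes above it in its column have been read, so zeros
    there suffice. *)
Lemma go_down_to (t : nat) (l : 'I_m) r p (y := val (letter_box l)) :
    going_down t r y.2 p -> (r <= y.1)%N ->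
    (forall w : boxes_of O, (val w).2 = y.2 -> (r <= (val w).1 < y.1)%N ->
       D w = Zero) ->
  partial_prod b D l p = (y.1 + y.2)%N :> nat.
Proof.
move=> down_t le_ry zeros.
have le_tl : (t <= l)%N.
  by rewrite -unread_letter -/y (surjective_pairing y) (proj2 down_t).
have [|w Ew le_rw|r' _ down_l] := going_down_run (l := l) _ down_t.
- by rewrite le_tl ltnW.
- rewrite (surjective_pairing (val w)) Ew unread_col -ltnNge => lt_wy.
  by apply: zeros; rewrite // le_rw.
by rewrite -(going_down_top down_l) (proj1 down_l).
Qed.

Lemma go_left_to (t : nat) (l : 'I_m) c p (x := val (letter_box l)) :
    going_left t x.1 c p -> (x.2 < c)%N ->
    (forall w : boxes_of O, (val w).1 = x.1 -> (x.2 < (val w).2 < c)%N ->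
       D w = Zero) ->
  partial_prod b D l p = (x.1 + x.2).+1 :> nat.
Proof.
move=> left_t lt_xc zeros.
have le_tl : (t <= l)%N.
  have [_ _ up] := left_t.
  by rewrite -unread_letter -/x (surjective_pairing x) up.
have [|w Ew lt_wc|c' _ left_l] := going_left_run (l := l) _ left_t.
- by rewrite le_tl ltnW.
- rewrite (surjective_pairing (val w)) Ew unread_row -ltnNge => lt_xw.
  by apply: zeros; rewrite // lt_wc andbT.
by have Ec := going_left_right left_l; case: left_l => _ -> _; rewrite Ec addnS.
Qed.

(** * Crossings and inversions of wires *)

Lemma Gamma_diagramP :
  Gamma_diagram b D <->
  forall (k : 'I_m) (p q : 'I_n), let z := val (letter_box k) in
    partial_prod b D k p = (z.1 + z.2)%N :> nat ->
    partial_prod b D k q = (z.1 + z.2).+1 :> nat -> (p < q)%N.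
Proof.
split=> [G k p q z Ep Eq | H k /=].
  have := G k; rewrite /= bruhat_lt_simple -/(letter_box k).
  set i := Ordinal (box_label_subproof _).
  have -> : Ordinal (adj_ltn0 i) = partial_prod b D k p by apply: val_inj.
  have -> : Ordinal (adj_ltn1 i) = partial_prod b D k q by apply: val_inj.
  by rewrite !permK.
rewrite bruhat_lt_simple -/(letter_box k).
by apply: (H k); rewrite permKV.
Qed.

(** A simple reflection changes the relative order of no pair but the one it swaps. *)
Lemma crossing_exists (k : nat) (p q : 'I_n) :
    (k <= m)%N -> (p < q)%N ->
    (partial_prod b D k q < partial_prod b D k p)%N ->
  exists l : 'I_m, let z := val (letter_box l) in
    [/\ (l < k)%N, D (letter_box l) = Zero,
        partial_prod b D l p = (z.1 + z.2)%N :> nat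
      & partial_prod b D l q = (z.1 + z.2).+1 :> nat].
Proof.
elim: k => [|k IHk] le_km lt_pq.
  by rewrite /partial_prod take0 big_nil !perm1; lia.
case: (ltnP (partial_prod b D k q) (partial_prod b D k p)) => [lt_k _|le_k].
  have [l [lt_lk Dl Ep Eq]] := IHk (ltnW le_km) lt_pq lt_k.
  by exists l; split=> //; apply: ltnW.
pose l : 'I_m := Ordinal le_km; rewrite -[k.+1]/(val l).+1.
have neq : partial_prod b D k p <> partial_prod b D k q :> nat.
  by move/val_inj/perm_inj => Epq; rewrite Epq ltnn in lt_pq.
case Dl: (D (letter_box l)); last by rewrite !partial_prodS_Plus //=; lia.
rewrite !partial_prodS_Zero //= => lt_l; exists l => /=; move: lt_l.
by do 4?case: eqP; split=> //; lia.
Qed.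

(** * The two implications *)

Definition bad_triple (z y x : boxes_of O) : Prop :=
  [/\ D z = Zero, is_below (val y) (val z) /\ D y = Plus
    & is_left_of (val x) (val z) /\ D x = Plus].

Lemma not_bad_Gamma : (forall z y x, ~ bad_triple z y x) -> Gamma_diagram b D.
Proof.
move=> good; apply/Gamma_diagramP => k p q z Ep Eq.
rewrite ltnNge; apply/negP; rewrite leq_eqVlt => /predU1P[/val_inj Epq|lt_qp].
  by move: Eq; rewrite Epq Ep; lia.
have [||l [lt_lk Dl Eql Epl]] := crossing_exists (k := k) _ lt_qp.
- exact: ltnW.
- by rewrite Ep Eq.
have run : (l < k <= m)%N by rewrite lt_lk ltnW.
(* Without a [Plus] below the crossing, [q] is still descending at time [k], yet sits on a right
   edge. *)
have down_q : (forall y, is_below (val y) (val (letter_box l)) -> D y = Zero) -> False.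
  move=> zeros; have [y Ey le_y _|r' _ down_k] := going_down_run run (cross_down Dl Eql).
    by apply: zeros; rewrite /is_below Ey eqxx.
  by have := going_down_letter down_k; case: down_k; rewrite Eq /z; lia.
(* Likewise [p] would still be going left, yet sits on a top edge. *)
have left_p : (forall x, is_left_of (val x) (val (letter_box l)) -> D x = Zero) -> False.
  move=> zeros; have [x Ex lt_x _|c' _ left_k] := going_left_run run (cross_left Dl Epl).
    by apply: zeros; rewrite /is_left_of Ex eqxx.
  by have := going_left_letter left_k; case: left_k => _; rewrite Ep /z; lia.
apply: left_p => x left_x; case Dx: (D x) => //; case: down_q => y below_y.
by case Dy: (D y) => //; case: (good (letter_box l) y x).
Qed.

Lemma bad_not_Gamma : Gamma_diagram b D -> forall z y x, ~ bad_triple z y x.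
Proof.
move/Gamma_diagramP=> G z y x.
(* Induction on the height plus the width of the rectangle. *)
have [N] := ubnP ((val y).1 - (val z).1 + ((val z).2 - (val x).2))%N.
elim: N z y x => // N IHN z y x lt_N [Dz [below_y Dy] [left_x Dx]].
have /andP[/eqP Ec lt_zy] := below_y; have /andP[/eqP Er lt_xz] := left_x.
have colz (w : boxes_of O) :
    (val w).2 = (val z).2 -> ((val z).1 < (val w).1 < (val y).1)%N -> D w = Zero.
  move=> Ew /andP[lt_zw lt_wy]; case Dw: (D w) => //; case: (IHN z w x); first lia.
  by split=> //; rewrite /is_below Ew eqxx.
have rowz (w : boxes_of O) :
    (val w).1 = (val z).1 -> ((val x).2 < (val w).2 < (val z).2)%N -> D w = Zero.
  move=> Ew /andP[lt_xw lt_wz]; case Dw: (D w) => //; case: (IHN z y w); first lia.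
  by split=> //; rewrite /is_left_of Ew eqxx.
have inO (r : 'I_j) (c : 'I_(n - j)) :
    ((val z).1 <= r)%N -> (c <= (val z).2)%N ->
    exists2 u : boxes_of O, (val u).1 = r & (val u).2 = c.
  move=> le_r le_c; have Orc : (r, c) \in O by apply: hO (valP z); apply: box_leP.
  by exists (exist _ (r, c) Orc).
(* A [Plus] at [w] would give a smaller bad triple, with the box [u] of the right side in the row of
   [w] as its [Zero]. *)
have coly (w : boxes_of O) :
    (val w).2 = (val x).2 -> ((val z).1 < (val w).1 < (val y).1)%N -> D w = Zero.
  move=> Ew lt_w; case Dw: (D w) => //.
  have [|//|u Eu1 Eu2] := inO (val w).1 (val z).2; first lia.
  case: (IHN u y w); first by rewrite Eu1 Eu2 Ew; lia.
  split; [by apply: colz; rewrite ?Eu1 | |].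
    by rewrite /is_below Eu1 Eu2 Ec eqxx; case/andP: lt_w.
  by rewrite /is_left_of Eu1 Eu2 Ew eqxx; case/andP: lt_w.
have rowy (w : boxes_of O) :
    (val w).1 = (val y).1 -> ((val x).2 < (val w).2 < (val z).2)%N -> D w = Zero.
  move=> Ew lt_w; case Dw: (D w) => //.
  have [//||u Eu1 Eu2] := inO (val z).1 (val w).2; first lia.
  case: (IHN u w x); first by rewrite Eu1 Eu2 Ew; lia.
  split; [by apply: rowz; rewrite ?Eu2 | |].
    by rewrite /is_below Eu1 Eu2 Ew eqxx; case/andP: lt_w.
  by rewrite /is_left_of Eu1 Eu2 Er eqxx; case/andP: lt_w.
(* The corner opposite to [z]. *)
have [||w Ew1 Ew2] := inO (val y).1 (val x).2; [exact: ltnW | exact: ltnW |].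
have [k Ek] := letter_boxP z; have [ky Eky] := letter_boxP y.
have [kx Ekx] := letter_boxP x; have [kw Ekw] := letter_boxP w.
pose i : 'I_n.-1 := Ordinal (box_label_subproof (val z)).
pose p := (partial_prod b D k)^-1 (Ordinal (adj_ltn0 i)).
pose q := (partial_prod b D k)^-1 (Ordinal (adj_ltn1 i)).
have Ep : partial_prod b D k p = ((val z).1 + (val z).2)%N :> nat by rewrite permKV.
have Eq : partial_prod b D k q = ((val z).1 + (val z).2).+1 :> nat by rewrite permKV.
have lt_pq : (p < q)%N by apply: (G k); rewrite Ek.
(* [p] descends to [y], turns left there and reaches the right edge of [w]; [q] goes left to [x],
   turns down there and reaches the top edge of [w]. *)
have Epy : partial_prod b D ky p = ((val y).1 + (val y).2)%N :> nat.
  rewrite -Eky; apply: (go_down_to (t := k.+1) (r := (val z).1.+1)); rewrite Eky //.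
    by rewrite Ec -Ek; apply: cross_down; rewrite Ek.
  by rewrite Ec.
have Eqx : partial_prod b D kx q = ((val x).1 + (val x).2).+1 :> nat.
  rewrite -Ekx; apply: (go_left_to (t := k.+1) (c := (val z).2)); rewrite Ekx //.
    by rewrite Er -Ek; apply: cross_left; rewrite Ek.
  by rewrite Er.
have Epw : partial_prod b D kw p = ((val w).1 + (val w).2).+1 :> nat.
  rewrite -Ekw; apply: (go_left_to (t := ky.+1) (c := (val z).2)); rewrite Ekw ?Ew1 ?Ew2 //.
  by rewrite -Ec -Eky; apply: turn_left; rewrite Eky.
have Eqw : partial_prod b D kw q = ((val w).1 + (val w).2)%N :> nat.
  rewrite -Ekw; apply: (go_down_to (t := kx.+1) (r := (val z).1.+1)); rewrite Ekw ?Ew1 ?Ew2 //.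
  by rewrite -Er -Ekx; apply: turn_down; rewrite Ekx.
(* The criterion at [w] demands [q < p], while at [z] it gave [p < q]. *)
by have := G kw q p; rewrite Ekw => /(_ Eqw Epw); lia.
Qed.

End Reading.

Local Close Scope group_scope.

Theorem mainTheorem1 (n j : nat) (hj : 1 <= j <= n - 1)
    (O : {set box n j}) (hO : order_ideal O)
    (m : nat) (b : m.-tuple (boxes_of O)) (hb : linear_extension b)
    (D : oplus_diagram O) :
  Gamma_diagram b D <->
  ~ (exists z : boxes_of O,
       [/\ D z = Zero,
           exists y : boxes_of O, is_below (val y) (val z) /\ D y = Plus
         & exists x : boxes_of O, is_left_of (val x) (val z) /\ D x = Plus]).
Proof.
split=> [G [z [Dz [y below_y] [x left_x]]]|good].
  exact: (bad_not_Gamma hO hb G (z := z) (y := y) (x := x)).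
apply: not_bad_Gamma => // z y x [Dz below_y left_x].
by apply: good; exists z; split=> //; [exists y | exists x].
Qed.
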